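(* Let $f=\sum_{i=0}^n a_ix^i\in\mathbb{Z}[x]$ with $n>0$, $a_n>0$, $a_0\neq0$ and $\gcd(a_0,\dots,a_n)=1$. Suppose $f$ has a unique positive root $x_+$ and every root $w$ of $f$ satisfies $|w|\leq x_+$. Suppose there exists a minimal integer $\delta>1$ such that, for all roots $z\neq x_+$ of $f$, $|z|=x_+$ implies $z^\delta\in\mathbb{R}_{>0}$. Let $f^*\in\mathbb{Z}[x]$ be the polynomial associated with $f$ and $\delta$ as in the context, so that $(f)_{\mathbb{Z}[x]}\cap\mathbb{Z}[x^\delta]=(f^*(x^\delta))_{\mathbb{Z}[x^\delta]}$. Then $f\in\Phi_1$ if and only if $\mathrm{lc}(f)=\mathrm{lc}(f^* )$ and $f^*\in\Phi_1$.
   Context: For $h\in\mathbb{Z}[x]$, $\mathrm{lc}(h)$ and $\mathrm{lt}(h)$ are the leading coefficient and leading term and $h^+,h^-\in\mathbb{N}[x]$ are the positive and negative parts, $h=h^+-h^-$ with no monomial occurring in both. $\Phi_0=\{h\in\mathbb{Z}[x]\mid \mathrm{lt}(h)=h^+\}$ and $\Phi_1=\{h\in\mathbb{Z}[x]\mid hg\in\Phi_0\text{ for some monic }g\in\mathbb{Z}[x]\}$. Definition of $f^*$ for a positive integer $\delta$: write $f=\prod_{j=1}^m q_j^{\alpha_j}$ with $\alpha_j\geq1$ and $q_j$ pairwise distinct primitive irreducible polynomials in $\mathbb{Z}[x]$ with positive leading coefficients. Let $q_j^*\in\mathbb{Z}[x]$, with positive leading coefficient, be such that $q_j^*(x^\delta)$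 is (up to sign) the square-free part of the Sylvester resultant $R_u(u^\delta-x^\delta,q_j(u))$ with respect to $u$. Then $f^*=\mathrm{lcm}\{(q_j^* )^{\alpha_j}\mid j=1,\dots,m\}$ (with positive leading coefficient). It satisfies $(f)_{\mathbb{Z}[x]}\cap\mathbb{Z}[x^\delta]=(f^*(x^\delta))_{\mathbb{Z}[x^\delta]}$, where $(\cdot)_R$ denotes the ideal of $R$ generated by the given element.
   Formalization: The minimal δ is taken among all positive integers and required to exceed 1, so some root z≠x_+ has |z|=x_+; otherwise δ=2 would hold vacuously and f=x^2-x-2, with f^*=(x-4)(x-1), would be a counterexample. *)

(* Defs.v *)
From HB Require Import structures.
From mathcomp Require Import all_boot all_order all_algebra all_field.

Set Implicit Arguments.
Unset Strict Implicit.
Unset Printing Implicit Defensive.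

Import Order.TTheory GRing.Theory Num.Theory.
Local Open Scope ring_scope.

Definition lead_term (h : {poly int}) : {poly int} :=
  lead_coef h *: 'X^((size h).-1).

Definition pos_part (h : {poly int}) : {poly int} :=
  \poly_(i < size h) Num.max (h`_i) 0.

Definition Phi0 (h : {poly int}) : Prop := lead_term h = pos_part h.

Definition Phi1 (h : {poly int}) : Prop :=
  exists2 g : {poly int}, g \is monic & Phi0 (h * g).

(* Divisibility in Z[x]; the relation [%|] of polydiv is pseudo-divisibility,
   which over int amounts to divisibility in Q[x]. *)
Definition zpdvd (p q : {poly int}) : Prop := exists r : {poly int}, q = r * p.

(* Irreducibility as an element of the ring Z[x]; [irreducible_poly] ignores
   constant factors. *)
Definition zpirreducible (p : {poly int}) : Prop :=
  [/\ p != 0, p \isn't a GRing.unit &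
      forall a b : {poly int},
        p = a * b -> a \is a GRing.unit \/ b \is a GRing.unit].

(* Positivity of the leading coefficients selects one irreducible in each class
   of associates, so distinct members are non-associated. *)
Definition distinct_irreducibles (m : nat) (q : 'I_m -> {poly int}) : Prop :=
  [/\ injective q, forall j, zpirreducible (q j)
    & forall j, 0 < lead_coef (q j)].

(* The product of the distinct irreducible factors, up to a unit of Z[x],
   that is, up to sign. *)
Definition is_squarefree_part (p s : {poly int}) : Prop :=
  exists (k : nat) (r : 'I_k -> {poly int}) (e : 'I_k -> nat)
         (u v : {poly int}),
    [/\ distinct_irreducibles r, forall i, (0 < e i)%N,
        u \is a GRing.unit /\ v \is a GRing.unit,
        p = u * \prod_(i < k) r i ^+ e i
      & s = v * \prod_(i < k) r i].

Definition is_zplcm (m : nat) (F : 'I_m -> {poly int}) (l : {poly int}) : Prop :=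
  [/\ 0 < lead_coef l, forall j, zpdvd (F j) l
    & forall h : {poly int}, (forall j, zpdvd (F j) h) -> zpdvd l h].

(* R_u(u^delta - x^delta, q(u)): the outer variable of {poly {poly int}} is u
   and the inner one is x. *)
Definition res_power (delta : nat) (q : {poly int}) : {poly int} :=
  resultant ('X^delta - ('X^delta)%:P : {poly {poly int}}) (map_poly polyC q).

Definition is_star_irr (delta : nat) (q qs : {poly int}) : Prop :=
  0 < lead_coef qs /\ is_squarefree_part (res_power delta q) (qs \Po 'X^delta).

(* [zcontents q = 1] says that q is primitive with positive leading
   coefficient. *)
Definition is_star (delta : nat) (f fs : {poly int}) : Prop :=
  exists (m : nat) (q qs : 'I_m -> {poly int}) (alpha : 'I_m -> nat),
    [/\ distinct_irreducibles q, forall j, zcontents (q j) = 1,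
        (forall j, (0 < alpha j)%N) /\ f = \prod_(j < m) q j ^+ alpha j,
        forall j, is_star_irr delta (q j) (qs j)
      & is_zplcm (fun j => qs j ^+ alpha j) fs].

Definition croot (f : {poly int}) (z : algC) : Prop :=
  root (map_poly intr f) z.

Definition peripheral_power (f : {poly int}) (xp : algC) (d : nat) : Prop :=
  forall z : algC, croot f z -> z != xp -> `|z| = xp -> 0 < z ^+ d.

(* Main.v *)
(* Suppose f g is in Phi_0 with g monic and N = deg (f g). At a root z of f with
   |z| = x_+, the relation lc z^N = sum_i b_i z^i with all b_i >= 0 is an equality
   case of the triangle inequality, so z^(N-i) = x_+^(N-i) whenever b_i <> 0.
   Minimality of delta then forces delta to divide every such N - i, that is,
   f g = x^r h(x^delta) with h in Phi_0. The rest is the ideal identity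
   (f) \cap Z[x^delta] = (f^*(x^delta)), followed by comparing leading
   coefficients. For the identity, q_j^* is primitive because the resultant does
   not vanish modulo any prime, its complex roots are simple and are delta-th
   powers of roots of q_j, and a nonzero w has the same multiplicity in h(x^delta)
   as w^delta has in h. *)
Require Import Defs.
From mathcomp Require Import all_boot all_order all_algebra all_field.
From mathcomp Require Import ring zify.
Set Implicit Arguments.
Unset Strict Implicit.
Unset Printing Implicit Defensive.

Import Order.TTheory GRing.Theory Num.Theory.
Local Open Scope ring_scope.

(** * Nonvanishing of the resultant over a field *)

(** The Sylvester matrix is formed before [phi] is applied, so it keeps its size even if [phi]
    lowers degrees, as reduction modulo a prime may. *)
Lemma mul_map_Sylvester_mx (aR rR : nzRingType) (phi : {rmorphism aR -> rR})
    (p q : {poly aR}) (v : 'rV[rR]_((size q).-1 + (size p).-1)) :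
  v *m map_mx phi (Sylvester_mx p q) =
  poly_rV (rVpoly (lsubmx v) * map_poly phi p
           + rVpoly (rsubmx v) * map_poly phi q).
Proof.
have band m (u : 'rV[rR]_m) d (r : {poly aR}) :
    u *m map_mx phi (lin1_mx (poly_rV \o r \o* rVpoly : _ -> 'rV_d)) =
    poly_rV (rVpoly u * map_poly phi r).
  rewrite -[RHS]/((poly_rV \o map_poly phi r \o* rVpoly) u) -mul_rV_lin1.
  congr (_ *m _); apply: map_lin1_mx => w.
  by rewrite map_poly_rV rmorphM /= map_rVpoly.
by rewrite -{1}[v]hsubmxK /Sylvester_mx map_col_mx mul_row_col !band linearD.
Qed.

(** The polynomial u^d - x^d is coprime to c(u), so a relation forces it to divide [v], whose degree
    in u is below d. *)
Lemma XnsubXn_map_polyC_syzygy (F : fieldType) (d : nat) (c : {poly F})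
    (a v : {poly {poly F}}) :
  (0 < d)%N -> c != 0 -> (size v <= d)%N ->
  a * ('X^d - ('X^d)%:P) + v * map_poly polyC c = 0 -> a = 0 /\ v = 0.
Proof.
move=> d_gt0 c_neq0 sz_v; set A := 'X^d - _ => eq0.
have monA : A \is monic by exact: monicXnsubC.
have sz_A : size A = d.+1 by exact: size_XnsubC.
(* Exchanging the variables turns [c] into a scalar and keeps [A] monic up to sign. *)
have v0 : v = 0.
  have swA : swapXY A = - A.
    rewrite /A rmorphB /= rmorphXn /= swapXY_X swapXY_polyC opprB.
    by rewrite map_polyXn rmorphXn.
  have : A %| swapXY v.
    rewrite -(Pdiv.Idomain.dvdpZr _ _ c_neq0).
    apply/(Pdiv.IdomainMonic.dvdpP monA); exists (swapXY a).
    move/(congr1 swapXY)/eqP: eq0.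
    rewrite rmorphD !rmorphM /= swapXY_map_polyC swA rmorph0.
    by rewrite mulrN addrC subr_eq0 mulrC mul_polyC => /eqP.
  case/(Pdiv.IdomainMonic.dvdpP monA) => w /(congr1 swapXY).
  rewrite swapXYK rmorphM /= swA mulrN -mulNr => vE.
  apply/eqP/idPn=> v_neq0; have w_neq0 : - swapXY w != 0.
    by apply: contraNneq v_neq0 => w0; rewrite vE w0 mul0r.
  move: sz_v; rewrite vE size_Mmonic // sz_A addnS /= => /leq_trans.
  move/(_ _ (leqnn _)); rewrite -[X in (_ <= X)%N]add0n leq_add2r leqn0.
  by rewrite size_poly_eq0 (negPf w_neq0).
split=> //; move/eqP: eq0; rewrite v0 mul0r addr0 mulf_eq0.
by rewrite (negPf (monic_neq0 monA)) orbF => /eqP.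
Qed.

(** A zero determinant gives a nonzero kernel vector, whose two halves are the cofactors of a
    relation excluded by the previous lemma. *)
Lemma map_res_power_neq0 (F : fieldType) (phi : {rmorphism int -> F}) (d : nat)
    (q : {poly int}) :
  (0 < d)%N -> map_poly phi q != 0 -> map_poly phi (res_power d q) != 0.
Proof.
move=> d_gt0 q_neq0; apply/negP; rewrite /res_power /resultant.
set A := 'X^d - _ : {poly {poly int}}.
rewrite -(det_map_mx (map_poly phi)) => /det0P[v v_neq0].
rewrite mul_map_Sylvester_mx.
have -> : map_poly (map_poly phi) A = 'X^d - ('X^d)%:P.
  by rewrite rmorphB /= map_polyXn map_polyC /= map_polyXn.
have -> : map_poly (map_poly phi) (map_poly polyC q) =
          map_poly polyC (map_poly phi q).
  by rewrite -!map_poly_comp; apply: eq_map_poly => c /=; rewrite map_polyC.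
have sz_A : size A = d.+1 by exact: size_XnsubC.
have szl := size_poly _ _ : (size (rVpoly (lsubmx v)) <= _)%N.
have szr := size_poly _ _ : (size (rVpoly (rsubmx v)) <= _)%N.
set a := rVpoly _ in szl *; set b := rVpoly _ in szr *.
move/(congr1 rVpoly); rewrite linear0 poly_rV_K.
  rewrite sz_A /= in szr.
  case/(XnsubXn_map_polyC_syzygy d_gt0 q_neq0 szr) => a0 b0.
  case/eqP: v_neq0; rewrite -[v]hsubmxK; apply/eqP; rewrite row_mx_eq0.
  by rewrite -[lsubmx v]rVpolyK -[rsubmx v]rVpolyK -/a -/b a0 b0 !linear0 !eqxx.
(* What remains is the degree bound under which [poly_rV] loses no coefficient. *)
have q_gt0 : (0 < size q)%N.
  by rewrite lt0n size_poly_eq0; apply: contraNneq q_neq0 => ->; rewrite map_poly0.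
rewrite (leq_trans (size_polyD _ _)) // geq_max.
have sz_qC : size (map_poly polyC q) = size q.
  by rewrite size_map_inj_poly //; exact: polyC_inj.
have sz_q' : (size (map_poly polyC (map_poly phi q)) <= size q)%N.
  by rewrite (leq_trans (size_poly _ _)) // (leq_trans (size_poly _ _)).
move: sz_q' szl szr; rewrite sz_A sz_qC => sz_q' szl szr.
rewrite !(leq_trans (size_polyMleq _ _)) // ?size_XnsubC //.
  by move: sz_q' szr q_gt0; move: (size (map_poly _ _)) (size b); lia.
by move: szl q_gt0; move: (size a); lia.
Qed.

(** * Divisibility, coprimality and irreducibles in Z[x] *)

Lemma dvdp_map_intr (F : numFieldType) (p q : {poly int}) :
  (map_poly (intr : int -> F) p %| map_poly intr q) = (p %| q).
Proof.
have ratr_intr r : map_poly ratr (map_poly intr r) = map_poly (intr : int -> F) r.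
  by rewrite -map_poly_comp; apply: eq_map_poly => c /=; rewrite ratr_int.
by rewrite -dvdp_rat_int -(dvdp_map (ratr : rat -> F)) !ratr_intr.
Qed.

Lemma coprimep_map_intr (F : numFieldType) (p q : {poly int}) :
  coprimep p q -> coprimep (map_poly (intr : int -> F) p) (map_poly intr q).
Proof.
case/Bezout_coprimepP=> -[u v] /=; rewrite -size_poly_eq1 => uv1.
apply/Bezout_coprimepP; exists (map_poly intr u, map_poly intr v) => /=.
rewrite -!rmorphM -rmorphD -size_poly_eq1 size_map_inj_poly //.
exact: intr_inj.
Qed.

Lemma zpdvd_primitive (p q : {poly int}) : zcontents p = 1 -> p %| q -> zpdvd p q.
Proof.
move=> p1 /dvdpP_int[r ->]; exists r.
by rewrite mulrC {2}[p]zpolyEprim p1 scale1r.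
Qed.

Lemma zpdvd_trans (q p r : {poly int}) : zpdvd p q -> zpdvd q r -> zpdvd p r.
Proof. by case=> a -> [b ->]; exists (b * a); rewrite mulrA. Qed.

Lemma zpdvd_dvdp (p q : {poly int}) : zpdvd p q -> p %| q.
Proof. by case=> r ->; exact: dvdp_mull. Qed.

Lemma zpdvd_exp (n : nat) (p q : {poly int}) : zpdvd p q -> zpdvd (p ^+ n) (q ^+ n).
Proof. by case=> r ->; exists (r ^+ n); rewrite exprMn. Qed.

Lemma zpdvd_comp (r p q : {poly int}) : zpdvd p q -> zpdvd (p \Po r) (q \Po r).
Proof. by case=> s ->; exists (s \Po r); rewrite comp_polyM. Qed.

Lemma zcontents_exp (p : {poly int}) (n : nat) : zcontents (p ^+ n) = zcontents p ^+ n.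
Proof.
elim: n => [|n IHn]; first by rewrite expr0 zcontents_monic ?monic1.
by rewrite !exprS zcontentsM IHn.
Qed.

(** Factor q as the primitive part of [gcdp q t] times a cofactor: one of the two is a unit. *)
Lemma zpirreducible_coprimep_or_dvd (q t : {poly int}) :
  zpirreducible q -> coprimep q t \/ zpdvd q t.
Proof.
case=> q_neq0 _ irr_q; set g := gcdp q t.
have /dvdpP_int[r qE] : g %| q by exact: dvdp_gcdl.
have /dvdpP_int[s tE] : g %| t by exact: dvdp_gcdr.
case: (irr_q _ _ qE) => [|r_unit].
  by rewrite poly_unitE size_zprimitive => /andP[gu _]; left; rewrite coprimep_def.
right; exists (s * r^-1).
by rewrite tE [X in _ = _ * X]qE mulrCA divrK.
Qed.

(** A nonzero derivative is too small to be a multiple of q. Constant irreducibles, the primes up to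
    sign, are covered because coprimality here is over Q. *)
Lemma zpirreducible_separable (q : {poly int}) :
  zpirreducible q -> separable_poly q.
Proof.
move=> irr_q; have [q_neq0 _ _] := irr_q.
rewrite separable_poly.unlock.
have [//|/zpdvd_dvdp q_dvd] := zpirreducible_coprimep_or_dvd q^`() irr_q.
have [dq0|dq_neq0] := eqVneq q^`() 0; last first.
  by have := dvdp_leq dq_neq0 q_dvd; rewrite leqNgt lt_size_deriv.
have sz_q : (size q <= 1)%N.
  rewrite leqNgt; apply/negP=> sz_gt1.
  have /eqP := congr1 (fun p : {poly int} => p`_(size q).-2) dq0.
  rewrite coef_deriv coef0.
  have -> : (size q).-2.+1 = (size q).-1 by case: (size q) sz_gt1 => [|[]].
  rewrite mulrn_eq0 -lead_coefE lead_coef_eq0 (negPf q_neq0) /=.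
  by case: (size q) sz_gt1 => [|[]].
rewrite dq0 coprimep0 -size_poly_eq1 eqn_leq sz_q lt0n size_poly_eq0.
exact: q_neq0.
Qed.

Lemma distinct_irreducibles_coprimep (m : nat) (r : 'I_m -> {poly int}) i j :
  distinct_irreducibles r -> i != j -> coprimep (r i) (r j).
Proof.
case=> r_inj r_irr r_lc ij.
have [//|[s rjE]] := zpirreducible_coprimep_or_dvd (r j) (r_irr i).
have [_ _ /(_ _ _ rjE) irr] := r_irr j.
have [_ ri_nunit _] := r_irr i.
case: irr => [s_unit|ri_unit]; last by rewrite ri_unit in ri_nunit.
(* Positive leading coefficients rule out s = -1. *)
have s1 : s = 1.
  move: s_unit; rewrite poly_unitE => /andP[/size_poly1P[c c_neq0 sE]].
  rewrite sE coefC eqxx; have := r_lc j; rewrite rjE sE lead_coefM lead_coefC.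
  rewrite pmulr_lgt0 // => c_gt0 cu.
  by congr (_%:P); case/orP: cu => /eqP c1; rewrite c1 in c_gt0 *.
by case/eqP: ij; apply: r_inj; rewrite rjE s1 mul1r.
Qed.

Lemma coprimep_bigprod (R : idomainType) (I : Type) (s : seq I) (P : pred I)
    (F : I -> {poly R}) (p : {poly R}) :
  (forall i, P i -> coprimep p (F i)) -> coprimep p (\prod_(i <- s | P i) F i).
Proof.
move=> cop; elim/big_ind: _ => //; first exact: coprimep1.
by move=> a b pa pb; rewrite coprimepMr pa.
Qed.

Lemma distinct_irreducibles_separable (m : nat) (r : 'I_m -> {poly int}) :
  distinct_irreducibles r -> separable_poly (\prod_(i < m) r i).
Proof.
move=> dr; have [_ irr _] := dr.
have : uniq (index_enum 'I_m) by exact: index_enum_uniq.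
elim: (index_enum _) => [_|i s IHs /= /andP[i_s s_uniq]].
  by rewrite big_nil separable_poly.unlock coprime1p.
rewrite big_cons separable_mul zpirreducible_separable // IHs //=.
rewrite big_seq_cond coprimep_bigprod // => j; rewrite andbT => js.
apply: distinct_irreducibles_coprimep => //.
by apply: contraNneq i_s => ->.
Qed.

Lemma distinct_irreducibles_prod_dvdp (m : nat) (q : 'I_m -> {poly int})
    (a : 'I_m -> nat) (h : {poly int}) :
  distinct_irreducibles q -> (forall j, q j ^+ a j %| h) ->
  \prod_(j < m) q j ^+ a j %| h.
Proof.
move=> dq dvd_h; have : uniq (index_enum 'I_m) by exact: index_enum_uniq.
elim: (index_enum _) => [_|i s IHs /= /andP[i_s s_uniq]].
  by rewrite big_nil dvd1p.
rewrite big_cons Gauss_dvdp ?dvd_h ?IHs //.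
rewrite big_seq_cond coprimep_bigprod // => j; rewrite andbT => js.
apply/coprimep_expl/coprimep_expr/distinct_irreducibles_coprimep => //.
by apply: contraNneq i_s => ->.
Qed.

(** * The resultant and its square-free part *)

(** The resultant lies in the ideal generated by u^d - x^d and q(u); putting u = x kills the first
    generator and turns the second into q. *)
Lemma zpdvd_res_power (d : nat) (q : {poly int}) :
  (0 < d)%N -> (1 < size q)%N -> zpdvd q (res_power d q).
Proof.
move=> d_gt0 q_gt1; rewrite /res_power.
set A := 'X^d - _ : {poly {poly int}}.
have sz_A : size A = d.+1 by exact: size_XnsubC.
have sz_q : size (map_poly polyC q) = size q.
  by rewrite size_map_inj_poly //; exact: polyC_inj.
have [||[u v] _ /(congr1 (horner^~ 'X)) /=] :=
    @resultant_in_ideal _ A (map_poly polyC q); rewrite ?sz_A ?sz_q //.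
rewrite hornerC hornerD !hornerM /A hornerD hornerN hornerXn hornerC subrr mulr0 add0r.
by move=> ->; exists v.['X]; congr (_ * _); exact: comp_polyXr.
Qed.

Lemma res_power_root (d : nat) (q : {poly int}) (x : algC) :
  (0 < d)%N -> q != 0 -> croot (res_power d q) x ->
  exists2 w, croot q w & w ^+ d = x ^+ d.
Proof.
move=> d_gt0 q_neq0; rewrite /croot /root /res_power.
set A := 'X^d - _ : {poly {poly int}}.
pose phi : {rmorphism {poly int} -> algC} :=
  horner_eval x \o map_poly (intr : int -> algC).
(* Evaluation of the inner variable commutes with the resultant because neither leading coefficient
   in u vanishes. *)
rewrite -[_.[x]]/(phi _) map_resultant; first last.
- rewrite lead_coef_map_inj ?rmorph0 //; last exact: polyC_inj.
  by rewrite /phi /= map_polyC /= /horner_eval hornerC intr_eq0 lead_coef_eq0.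
- by rewrite lead_coefXnsubC // rmorph1 oner_neq0.
rewrite resultant_eq0 => sz_g.
have /closed_rootP[w] : size (gcdp (map_poly phi A) (map_poly phi (map_poly polyC q))) != 1.
  by rewrite neq_ltn sz_g orbT.
rewrite root_gcd => /andP[rA rq]; exists w.
  move: rq; rewrite -map_poly_comp; congr (root _ w); apply: eq_map_poly => c /=.
  by rewrite map_polyC /= /horner_eval hornerC.
move: rA; rewrite rmorphB /= map_polyXn map_polyC /= map_polyXn /horner_eval.
by rewrite hornerXn rootE !hornerE ?hornerXn subr_eq0 => /eqP.
Qed.

Lemma squarefree_part_zpdvd (p s : {poly int}) : is_squarefree_part p s -> zpdvd s p.
Proof.
case=> k [r [e [u [v [_ e_gt0 [_ vu] -> ->]]]]].
exists (u * v^-1 * \prod_(i < k) r i ^+ (e i).-1).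
have -> : \prod_(i < k) r i ^+ e i =
    (\prod_(i < k) r i ^+ (e i).-1) * \prod_(i < k) r i.
  by rewrite -big_split /=; apply: eq_bigr => i _; rewrite -exprSr prednK.
by rewrite -[LHS](mulKr vu); ring.
Qed.

Lemma squarefree_part_separable (p s : {poly int}) :
  is_squarefree_part p s -> separable_poly s.
Proof.
case=> k [r [e [u [v [dr _ [_ vu] _ ->]]]]].
rewrite separable_mul distinct_irreducibles_separable //.
have sz_v : size v == 1 by move: vu; rewrite poly_unitE => /andP[].
have cop w : coprimep v w.
  by rewrite (eqp_coprimepl _ (_ : v %= 1)) ?coprime1p // -size_poly_eq1.
by rewrite separable_poly.unlock !cop.
Qed.

Lemma squarefree_part_dvd_exp (p s : {poly int}) :
  is_squarefree_part p s -> exists n, p %| s ^+ n.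
Proof.
case=> k [r [e [u [v [_ _ [uu _] -> ->]]]]]; exists (\sum_i e i)%N.
have sz_u : u %= 1 by move: uu; rewrite poly_unitE -size_poly_eq1 => /andP[].
rewrite (eqp_dvdl _ (eqp_mulr _ sz_u)) mul1r exprMn dvdp_mull // -prodrXl.
elim/big_ind2: _ => // [a b c f ab cf|i _].
  exact: dvdp_mul.
by apply: dvdp_exp2l; rewrite (bigD1 i) //= leq_addr.
Qed.

Lemma map_polyFp_eq0 (p : nat) (q : {poly int}) :
  prime p -> (map_poly (intr : int -> 'F_p) q == 0) = (p %| zcontents q)%Z.
Proof.
move=> p_pr; rewrite dvdz_contents; apply/eqP/polyOverP => [q0 i|q0].
  by have := congr1 (fun r : {poly 'F_p} => r`_i) q0;
    rewrite coef_map coef0 /= => /eqP; rewrite -(dvdz_pcharf (pchar_Fp p_pr)).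
apply/polyP=> i; rewrite coef_map coef0 /=; apply/eqP.
by rewrite -(dvdz_pcharf (pchar_Fp p_pr)); exact: q0.
Qed.

(** * The polynomial q^* of a primitive irreducible q *)

Section StarOfIrreducible.

Variables (d : nat) (q qs : {poly int}).
Hypotheses (d_gt0 : (0 < d)%N) (q_irr : zpirreducible q).
Hypotheses (q_prim : zcontents q = 1) (qs_star : is_star_irr d q qs).

Let q_neq0 : q != 0. Proof. by case: q_irr. Qed.

Lemma primitive_irreducible_size_gt1 : (1 < size q)%N.
Proof.
rewrite ltnNge; apply/negP=> sz_q; have [_ /negP[]] := q_irr.
have [c qE] : exists c, q = c%:P by exists q`_0; exact: size1_polyC.
move: q_prim; rewrite qE -[c%:P]mulr1 mul_polyC zcontentsZ.
by rewrite zcontents_monic ?monic1 // mulr1 => ->; rewrite scale1r unitr1.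
Qed.

(** If a prime p divided the content, q^*(x^d) and hence its multiple the resultant would vanish
    modulo p, although q does not. *)
Lemma star_irr_primitive : zcontents qs = 1.
Proof.
have [lc_qs sqf] := qs_star.
have c_gt0 : 0 < zcontents qs by rewrite -sgz_gt0 sgz_contents sgz_gt0.
apply/eqP/idPn=> c_neq1; set c := zcontents qs in c_gt0 c_neq1.
have c_gt1 : (1 < `|c|)%N by lia.
pose p := pdiv `|c|; have p_pr : prime p by exact: pdiv_prime.
have : map_poly (intr : int -> 'F_p) (res_power d q) != 0.
  by rewrite map_res_power_neq0 // map_polyFp_eq0 // q_prim dvdz1 eqn_leq leqNgt prime_gt1.
have [r ->] := squarefree_part_zpdvd sqf.
rewrite rmorphM /= map_comp_poly /= (_ : map_poly _ qs = 0).
  by rewrite comp_poly0 mulr0 eqxx.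
by apply/eqP; rewrite map_polyFp_eq0 // dvdzE; exact: pdiv_dvd.
Qed.

(** As q divides the resultant, which divides a power of q^*(x^d), coprimality to q^*(x^d) would
    make q coprime to itself. *)
Lemma star_irr_zpdvd : zpdvd q (qs \Po 'X^d).
Proof.
have [_ sqf] := qs_star.
have [cop|//] := zpirreducible_coprimep_or_dvd (qs \Po 'X^d) q_irr.
have [n dvd_n] := squarefree_part_dvd_exp sqf.
have /zpdvd_dvdp q_dvd := zpdvd_res_power d_gt0 primitive_irreducible_size_gt1.
have := coprimep_dvdl (dvdp_trans q_dvd dvd_n) (coprimep_expr n cop).
by rewrite coprimepp eqn_leq leqNgt primitive_irreducible_size_gt1.
Qed.

Lemma star_irr_root (y : algC) : croot qs y -> exists2 w, croot q w & w ^+ d = y.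
Proof.
move=> qs_y; have [_ sqf] := qs_star.
have [r rE] := squarefree_part_zpdvd sqf.
have R_x : croot (res_power d q) (d.-root y).
  rewrite rE /croot rmorphM rootM /= map_comp_poly /= root_comp map_polyXn hornerXn.
  by rewrite rootCK // -/(croot qs y) qs_y orbT.
have [w q_w wE] := res_power_root d_gt0 q_neq0 R_x.
by exists w => //; rewrite wE rootCK.
Qed.

(** By the chain rule, a d-th root of a common root of q^* and its derivative would be a common root
    of q^*(x^d) and its derivative. *)
Lemma star_irr_separable : separable_poly (map_poly (intr : int -> algC) qs).
Proof.
have [_ sqf] := qs_star.
have := squarefree_part_separable sqf; rewrite !separable_poly.unlock.
move=> /(coprimep_map_intr algC) cop; apply: Pdiv.ClosedField.root_coprimep => y qs_y.
have xE : (d.-root y) ^+ d = y by exact: rootCK.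
have : root (map_poly (intr : int -> algC) (qs \Po 'X^d)) (d.-root y).
  by rewrite map_comp_poly /= root_comp map_polyXn hornerXn xE.
move/(coprimep_root cop); rewrite deriv_comp rmorphM /= map_comp_poly /= hornerM.
by rewrite horner_comp map_polyXn hornerXn xE mulf_eq0 negb_or deriv_map => /andP[].
Qed.

End StarOfIrreducible.

(** * Multiplicities of roots under x -> x^d *)

Lemma XsubC_exp_dvd_comp_Xn (F : numFieldType) (h : {poly F}) (w : F) (a d : nat) :
  (0 < d)%N -> w != 0 -> ('X - w%:P) ^+ a %| h \Po 'X^d ->
  ('X - (w ^+ d)%:P) ^+ a %| h.
Proof.
move=> d_gt0 w_neq0; have [->|h_neq0] := eqVneq h 0; first by rewrite dvdp0.
have [k [g]] := multiplicity_XsubC h (w ^+ d); rewrite h_neq0 /= => gw ->.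
have [t tE] : exists t, 'X^d - (w ^+ d)%:P = t * ('X - w%:P).
  by apply/factor_theorem; rewrite rootE !hornerE ?hornerXn subrr.
(* [w] is a simple root of [X^d - w^d] because [w] is nonzero. *)
have tw : ~~ root t w.
  have /(congr1 (horner^~ w)) := congr1 (@deriv F) tE.
  rewrite derivM !derivB !derivC derivX derivXn !subr0 mulr1.
  rewrite hornerD hornerM hornerXsubC subrr mulr0 add0r hornerMn hornerXn rootE => <-.
  by rewrite mulrn_eq0 negb_or -lt0n d_gt0 /= expf_neq0.
rewrite comp_polyM rmorphXn /= comp_polyB comp_polyX comp_polyC tE exprMn mulrA.
(* Neither g(X^d) nor t^k vanishes at w, so the power of X - w must divide (X - w)^k. *)
rewrite Gauss_dvdpr; last first.
  rewrite coprimep_expl // coprimep_sym coprimep_XsubC rootM root_comp hornerXn.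
  by rewrite negb_or gw /= rootE horner_exp expf_neq0.
rewrite dvdp_Pexp2l ?size_XsubC // => le_ak.
by rewrite dvdp_mull // dvdp_exp2l.
Qed.

Lemma separable_exp_dvdp (F : closedFieldType) (p h : {poly F}) (a : nat) :
  separable_poly p -> (forall y, root p y -> ('X - y%:P) ^+ a %| h) -> p ^+ a %| h.
Proof.
move=> sep_p dvd_h; have [rs pE] := closed_field_poly_normal p.
have p_neq0 : p != 0 by exact: separable_poly_neq0.
have lc_neq0 : lead_coef p != 0 by rewrite lead_coef_eq0.
have rs_root y : y \in rs -> root p y.
  by move=> y_rs; rewrite pE rootZ // root_prod_XsubC.
rewrite pE exprZn dvdpZl ?expf_neq0 //.
move: sep_p; rewrite pE -mul_polyC separable_mul separable_prod_XsubC => /and3P[_ rs_uniq _].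
elim: rs rs_root rs_uniq {pE} => [|y s IHs] rs_root /=.
  by rewrite big_nil expr1n dvd1p.
case/andP=> y_s s_uniq; rewrite big_cons exprMn Gauss_dvdp.
  rewrite dvd_h ?rs_root ?mem_head // IHs // => z z_s.
  by rewrite rs_root // inE z_s orbT.
rewrite coprimep_expl // coprimep_expr // coprimep_sym coprimep_XsubC.
by rewrite root_prod_XsubC.
Qed.

(** Each root of q^* is w^d for a root w of q, nonzero because q(0) is; so its multiplicity in h is
    at least a. Simplicity of the roots assembles these into divisibility over [algC], and
    primitivity brings it down to Z[x]. *)
Lemma star_irr_exp_zpdvd (d : nat) (q qs h : {poly int}) (a : nat) :
  (0 < d)%N -> zpirreducible q -> zcontents q = 1 -> is_star_irr d q qs ->
  q`_0 != 0 -> zpdvd (q ^+ a) (h \Po 'X^d) -> zpdvd (qs ^+ a) h.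
Proof.
move=> d_gt0 q_irr q_prim q_star q0 /zpdvd_dvdp; rewrite -(dvdp_map_intr algC).
rewrite rmorphXn map_comp_poly /= map_polyXn => dvd_h.
apply: zpdvd_primitive.
  by rewrite zcontents_exp (star_irr_primitive d_gt0 q_irr q_prim q_star) expr1n.
rewrite -(dvdp_map_intr algC) rmorphXn /=; apply: separable_exp_dvdp.
  exact: star_irr_separable q_star.
move=> y /(star_irr_root d_gt0 q_irr q_star)[w q_w <-].
apply: XsubC_exp_dvd_comp_Xn => //; last first.
  by apply: dvdp_trans dvd_h; apply: dvdp_exp2r; rewrite dvdp_XsubCl.
apply: contraNneq q0 => w0; move: q_w; rewrite w0 /croot /root horner_coef0 coef_map.
by rewrite intr_eq0.
Qed.

(** * The two inclusions of the ideal identity *)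

Lemma star_primitive (d : nat) (f fs : {poly int}) :
  is_star d f fs -> zcontents f = 1.
Proof.
case=> m [q [qs [a [_ q_prim [_ ->] _ _]]]].
elim/big_ind: _ => [|b c b1 c1|j _]; first by rewrite zcontents_monic ?monic1.
  by rewrite zcontentsM b1 c1.
by rewrite zcontents_exp q_prim expr1n.
Qed.

Lemma star_zpdvd_comp (d : nat) (f fs : {poly int}) :
  (0 < d)%N -> is_star d f fs -> zpdvd f (fs \Po 'X^d).
Proof.
move=> d_gt0 f_star; apply: zpdvd_primitive; first exact: star_primitive f_star.
case: f_star => m [q [qs [a [dq q_prim [_ fE] qs_star [_ fs_dvd _]]]]].
have [_ q_irr _] := dq.
rewrite fE; apply: distinct_irreducibles_prod_dvdp => // j.
apply/zpdvd_dvdp/(@zpdvd_trans ((qs j \Po 'X^d) ^+ a j)).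
  by apply/zpdvd_exp/star_irr_zpdvd.
by rewrite -rmorphXn; apply: zpdvd_comp.
Qed.

(** The universal property of the lcm reduces the claim to one irreducible factor at a time. *)
Lemma zpdvd_comp_star (d : nat) (f fs h : {poly int}) :
  (0 < d)%N -> f`_0 != 0 -> is_star d f fs -> zpdvd f (h \Po 'X^d) -> zpdvd fs h.
Proof.
move=> d_gt0 f0 [m [q [qs [a [[_ q_irr _] q_prim [a_gt0 fE] qs_star [_ _ fs_min]]]]]].
move=> f_dvd; apply: fs_min => j.
have qf : zpdvd (q j ^+ a j) f.
  by exists (\prod_(i < m | i != j) q i ^+ a i); rewrite fE (bigD1 j) //= mulrC.
apply: (star_irr_exp_zpdvd d_gt0 (q_irr j) (q_prim j) (qs_star j)); last first.
  exact: zpdvd_trans qf f_dvd.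
apply: contraNneq f0 => q0; case: qf => r ->.
by rewrite coef0M -(prednK (a_gt0 j)) exprS coef0M q0 mul0r mulr0.
Qed.

(** * Sign patterns of Phi_0 and roots of maximal modulus *)

Lemma Phi0_coef_le0 (h : {poly int}) (i : nat) :
  Phi0 h -> i != (size h).-1 -> h`_i <= 0.
Proof.
move=> /(congr1 (fun p : {poly int} => p`_i)).
rewrite coefZ coefXn coef_poly => hE i_neq; move: hE; rewrite (negPf i_neq) mulr0.
case: ltnP => [_ max0|le_i _]; last by rewrite nth_default.
by rewrite [leRHS]max0 le_max lexx.
Qed.

Lemma coef_le0_Phi0 (h : {poly int}) :
  0 <= lead_coef h -> (forall i, i != (size h).-1 -> h`_i <= 0) -> Phi0 h.
Proof.
move=> lc_ge0 h_le0; apply/polyP=> i; rewrite coefZ coefXn coef_poly.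
have [->|i_neq] := eqVneq i (size h).-1.
  rewrite mulr1 -lead_coefE max_l //; case: ltnP => //.
  have [->|h_neq0] := eqVneq h 0; first by rewrite lead_coef0.
  by rewrite leqNgt prednK ?leqnn ?lt0n ?size_poly_eq0.
by rewrite mulr0; case: ltnP => // _; rewrite max_r ?h_le0.
Qed.

Lemma size_comp_Xn (R : idomainType) (d : nat) (h : {poly R}) :
  (0 < d)%N -> (size (h \Po 'X^d)).-1 = ((size h).-1 * d)%N.
Proof. by move=> d_gt0; rewrite size_comp_poly size_polyXn. Qed.

Lemma lead_coef_comp_Xn (R : idomainType) (d : nat) (h : {poly R}) :
  (0 < d)%N -> lead_coef (h \Po 'X^d) = lead_coef h.
Proof.
by move=> d_gt0; rewrite lead_coef_comp ?size_polyXn // lead_coefXn expr1n mulr1.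
Qed.

Lemma Phi0_comp_Xn (d : nat) (h : {poly int}) :
  (0 < d)%N -> 0 <= lead_coef h -> Phi0 h -> Phi0 (h \Po 'X^d).
Proof.
move=> d_gt0 lc_ge0 h_Phi0; apply: coef_le0_Phi0; first by rewrite lead_coef_comp_Xn.
move=> i; rewrite size_comp_Xn // coef_comp_poly_Xn //.
case: ifP => // /dvdnP[k ->]; rewrite mulnK // eqn_pmul2r // => k_neq.
exact: Phi0_coef_le0.
Qed.

(* Equality case of the triangle inequality in [lc(h) z^N = sum_i (- h_i) z^i]. *)
Lemma Phi0_peripheral_root (h : {poly int}) (x z : algC) (i : nat) :
  Phi0 h -> 0 < x -> croot h x -> croot h z -> `|z| = x ->
  (i < (size h).-1)%N -> h`_i != 0 -> z ^+ ((size h).-1 - i) = x ^+ ((size h).-1 - i).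
Proof.
move=> h_Phi0 x_gt0 hx hz zx; set N := (size h).-1 => i_lt hi.
have sz_h : size h = N.+1.
  by rewrite prednK // lt0n size_poly_eq0; apply: contraNneq hi => ->; rewrite coef0.
have z_neq0 : z != 0 by rewrite -normr_gt0 zx.
have x_neq0 : x != 0 by rewrite gt_eqF.
have evalE y : croot h y ->
    \sum_(j < N) (- h`_j)%:~R * y ^+ j = (lead_coef h)%:~R * y ^+ N :> algC.
  rewrite /croot rootE horner_coef size_map_inj_poly ?rmorph0 //; last exact: intr_inj.
  rewrite sz_h big_ord_recr /= coef_map /= addrC addr_eq0 lead_coefE sz_h /= => /eqP->.
  by rewrite -sumrN; apply: eq_bigr => j _; rewrite coef_map /= rmorphN mulNr.
have le0 (j : 'I_N) : h`_j <= 0.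
  by apply: Phi0_coef_le0 => //; rewrite -/N ltn_eqF.
(* The factor u has modulus 1 and rotates the sum at z onto the sum at x, whose terms are the
   moduli; equality then holds term by term. *)
pose u := (x / z) ^+ N.
have normu : `|u| = 1 by rewrite normrX normrM normfV zx gtr0_norm // divff ?expr1n.
have : (- h`_(Ordinal i_lt))%:~R * z ^+ i * u = (- h`_(Ordinal i_lt))%:~R * x ^+ i :> algC.
  apply: (@normC_sum_upper _ _ xpredT
    (fun j : 'I_N => (- h`_j)%:~R * z ^+ j * u) (fun j : 'I_N => (- h`_j)%:~R * x ^+ j)) => //.
    move=> j _; rewrite !normrM normu mulr1 normrX zx ger0_norm //.
    by rewrite ler0z oppr_ge0.
  rewrite -mulr_suml !evalE // /u expr_div_n -mulrA; congr (_ * _).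
  by rewrite mulrCA divff ?mulr1 // expf_neq0.
rewrite -mulrA /= => /mulfI; rewrite intr_eq0 oppr_eq0 => /(_ hi).
rewrite /u expr_div_n -(subnK (ltnW i_lt)) addnK !exprD => uE.
have [xi_neq0 zi_neq0] : x ^+ i != 0 /\ z ^+ i != 0 by rewrite !expf_neq0.
have zNi_neq0 : z ^+ (N - i) != 0 by rewrite expf_neq0.
apply/(mulIf xi_neq0); rewrite -[in LHS]uE.
move: (z ^+ i) (z ^+ (N - i)) (x ^+ i) zi_neq0 zNi_neq0 => a b c a0 b0.
by field; rewrite a0.
Qed.

Lemma coef_mod_decomp (R : nzRingType) (h : {poly R}) (d : nat) :
  (0 < d)%N -> (forall i, h`_i != 0 -> i = (size h).-1 %[mod d]) ->
  exists g : {poly R}, h = 'X^((size h).-1 %% d) * (g \Po 'X^d).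
Proof.
move=> d_gt0 h_mod; set r := ((size h).-1 %% d)%N in h_mod *.
(* The bound [size h] is generous: the coefficients beyond the true degree are zero. *)
exists (\poly_(k < size h) h`_(k * d + r)); apply/polyP=> i.
rewrite coefXnM coef_comp_poly_Xn // coef_poly.
have h0 : (i %% d)%N != r -> h`_i = 0.
  by move=> ir; apply/eqP; apply: contraNT ir => /h_mod ->.
case: ltnP => [lt_ir|le_ri].
  rewrite h0 // modn_small ?(ltn_trans lt_ir) ?ltn_pmod // ltn_eqF //.
case: ifP => [/dvdnP[k kE]|ndvd].
  rewrite kE mulnK // -kE subnK //; case: ltnP => // le_k.
  rewrite nth_default // (leq_trans le_k) // -(subnK le_ri) kE.
  by rewrite (leq_trans (leq_pmulr k d_gt0)) // leq_addr.
apply: h0; apply: contraFneq ndvd => ir.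
by rewrite -(eqn_mod_dvd d le_ri) ir modn_mod.
Qed.

(** Otherwise let r > 0 be the remainder of N - i modulo [delta]. As z^(N-i) = x_+^(N-i) and z^delta
    are positive, so is z^r, against the minimality of [delta]. *)
Lemma Phi0_multiple_dvd_gap (f h : {poly int}) (xp : algC) (delta i : nat) :
  0 < xp -> croot f xp -> peripheral_power f xp delta -> (0 < delta)%N ->
  (forall d : nat, (0 < d)%N -> peripheral_power f xp d -> (delta <= d)%N) ->
  zpdvd f h -> Phi0 h -> (i < (size h).-1)%N -> h`_i != 0 ->
  (delta %| (size h).-1 - i)%N.
Proof.
move=> xp_gt0 f_xp f_delta delta_gt0 delta_min [g hE] h_Phi0 i_lt hi.
have f_h z : croot f z -> croot h z by rewrite hE /croot rmorphM rootM orbC => ->.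
set N := (size h).-1 in i_lt *.
rewrite /dvdn -leqn0 leqNgt; apply/negP=> r_gt0.
have := ltn_pmod (N - i) delta_gt0; rewrite ltnNge delta_min // => z f_z z_neq zx.
have := Phi0_peripheral_root h_Phi0 xp_gt0 (f_h _ f_xp) (f_h _ f_z) zx i_lt hi.
rewrite -/N {1}(divn_eq (N - i) delta) exprD mulnC exprM => zE.
have : 0 < xp ^+ (N - i) by exact: exprn_gt0.
by rewrite -zE pmulr_rgt0 // exprn_gt0 // f_delta.
Qed.

(** * Transfer of Phi_1 between f and f^* *)

Theorem theorem4p9 (f fs : {poly int}) (xp : algC) (delta : nat)
  (f_deg : (0 < (size f).-1)%N)
  (f_lc : 0 < lead_coef f)
  (f_a0 : f`_0 != 0)
  (f_prim : \big[gcdz/0]_(i < size f) f`_i = 1)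
  (xp_pos : 0 < xp)
  (xp_root : croot f xp)
  (xp_unique : forall y : algC, 0 < y -> croot f y -> y = xp)
  (xp_max : forall w : algC, croot f w -> `|w| <= xp)
  (delta_gt1 : (1 < delta)%N)
  (delta_power : peripheral_power f xp delta)
  (delta_min : forall d : nat,
     (0 < d)%N -> peripheral_power f xp d -> (delta <= d)%N)
  (f_star : is_star delta f fs) :
  Phi1 f <-> lead_coef f = lead_coef fs /\ Phi1 fs.
Proof.
have delta_gt0 : (0 < delta)%N by exact: ltnW.
have [t tE] := star_zpdvd_comp delta_gt0 f_star.
have fs_lc : 0 < lead_coef fs by case: f_star => ? [? [? [? [_ _ _ _ []]]]].
have lcE : lead_coef fs = lead_coef t * lead_coef f.
  by rewrite -lead_coefM -tE lead_coef_comp_Xn.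
split=> [[g g_monic fg_Phi0]|[lc_eq [g g_monic fsg_Phi0]]]; last first.
  (* With f^*(x^delta) = t f, this multiplier turns f into (f^* g)(x^delta); equal leading
     coefficients make t monic. *)
  exists (t * (g \Po 'X^delta)).
    rewrite monicE lead_coefM lead_coef_comp_Xn // (monicP g_monic) mulr1.
    by apply/eqP/(mulIf (lt0r_neq0 f_lc)); rewrite -lcE lc_eq mul1r.
  rewrite mulrA [f * t]mulrC -tE -comp_polyM; apply: Phi0_comp_Xn => //.
  by rewrite lead_coefM (monicP g_monic) mulr1 ltW.
have f_dvd : zpdvd f (f * g) by exists g; rewrite mulrC.
have [|h hE] := @coef_mod_decomp _ (f * g) _ delta_gt0.
  move=> i hi; have [lt_i|gt_i|->//] := ltngtP i (size (f * g)).-1; last first.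
    move: hi; rewrite nth_default ?eqxx //.
    by move: gt_i; case: (size _).
  apply/eqP; rewrite eq_sym eqn_mod_dvd ?(ltnW lt_i) //.
  exact: (Phi0_multiple_dvd_gap xp_pos xp_root delta_power delta_gt0 delta_min f_dvd).
set r := (_ %% _)%N in hE.
have lc_h : lead_coef h = lead_coef f.
  have := congr1 lead_coef hE; rewrite !lead_coefM (monicP g_monic) mulr1.
  by rewrite lead_coefXn mul1r lead_coef_comp_Xn // => ->.
(* Since f(0) is nonzero, f is coprime to x^r and so divides h(x^delta). *)
have [w wE] : zpdvd fs h.
  apply: (zpdvd_comp_star delta_gt0 f_a0 f_star).
  apply: zpdvd_primitive; first exact: star_primitive f_star.
  rewrite -(@Gauss_dvdpr _ _ 'X^r) -?hE ?dvdp_mulr //.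
  by rewrite coprimep_expr // coprimepX /root horner_coef0.
have lc_hE : lead_coef f = lead_coef w * lead_coef fs by rewrite -lc_h wE lead_coefM.
have w_gt0 : 0 < lead_coef w by rewrite -(pmulr_lgt0 _ fs_lc) -lc_hE.
have t_gt0 : 0 < lead_coef t by rewrite -(pmulr_lgt0 _ f_lc) -lcE.
(* The leading coefficients of f and f^* divide each other, and the two positive integer quotients
   have product 1. *)
have w1 : lead_coef w = 1.
  have /eqP : lead_coef w * lead_coef t = 1.
    by apply: (mulIf (lt0r_neq0 f_lc)); rewrite -mulrA -lcE -lc_hE mul1r.
  by nia.
split; first by rewrite lc_hE w1 mul1r.
exists w; first exact/monicP.
rewrite mulrC -wE; apply: coef_le0_Phi0; first by rewrite lc_h ltW.
(* The coefficient of h at k is that of f g at k delta + r, and this index is the degree of f g only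
   when k is the degree of h. *)
move=> k k_neq; have := congr1 (fun p : {poly int} => p`_(k * delta + r)) hE.
rewrite coefXnM ltnNge leq_addl /= addnK coef_comp_poly_Xn // dvdn_mull // mulnK // => <-.
apply: Phi0_coef_le0 => //; apply: contraNneq k_neq => kE.
have h_neq0 : h != 0 by rewrite -lead_coef_eq0 lc_h gt_eqF.
have sz_fg : (size (f * g)).-1 = ((size h).-1 * delta + r)%N.
  rewrite hE -(size_comp_Xn _ delta_gt0).
  have : h \Po 'X^delta != 0 by rewrite -lead_coef_eq0 lead_coef_comp_Xn // lead_coef_eq0.
  move=> G_neq0; rewrite size_monicM ?monicXn // size_polyXn.
  move: G_neq0; rewrite -size_poly_gt0; case: (size _) => // s _.
  by rewrite addSn addnS /= addnC.
by apply/eqP; move: kE; rewrite sz_fg => /addIn/eqP; rewrite eqn_pmul2r // => /eqP.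
Qed.
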